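(* If $G$ is a graph of order $n$ and size $m$, then $$\psi_3(G) \le \frac{n+m}{4},$$ where equality holds if and only if all (connected) components of $G$ are isomorphic to the cycle $C_4$.
   Context: Graphs are finite, simple and undirected. The order of $G$ is $n=|V(G)|$ and its size is $m=|E(G)|$. $P_k$ denotes the path with $k$ vertices and $C_k$ the cycle with $k$ vertices. A $k$-path vertex cover of $G$ is a set $T\subseteq V(G)$ such that $G-T$ contains no (not necessarily induced) subgraph isomorphic to $P_k$; equivalently, $T$ shares a vertex with every path subgraph of order $k$ in $G$. $\psi_k(G)$ is the minimum cardinality of a $k$-path vertex cover of $G$. *)

(* Defs.v *)
From HB Require Import structures.
From mathcomp Require Import all_boot.
Set Implicit Arguments.
Unset Strict Implicit.
Unset Printing Implicit Defensive.

Record sgraph := SGraph {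
  vertex :> finType;
  adj : rel vertex;
  adj_sym : symmetric adj;
  adj_irr : irreflexive adj }.

Definition order_of (G : sgraph) : nat := #|G|.

Definition edges (G : sgraph) : {set {set G}} :=
  [set [set p.1; p.2] | p : G * G & adj p.1 p.2].

Definition size_of (G : sgraph) : nat := #|edges G|.

Section Induced.
Variables (G : sgraph) (A : {set G}).

Definition induced_rel : rel {x : G | x \in A} :=
  fun x y => adj (val x) (val y).

Fact induced_sym : symmetric induced_rel.
Proof. by move=> x y; apply: adj_sym. Qed.

Fact induced_irr : irreflexive induced_rel.
Proof. by move=> x; apply: adj_irr. Qed.

Definition induced : sgraph := SGraph induced_sym induced_irr.
End Induced.

Section PathCycle.
Variable k : nat.

Definition path_rel : rel 'I_k := fun i j => (i.+1 == j) || (j.+1 == i).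

Fact path_sym : symmetric path_rel.
Proof. by move=> i j; rewrite /path_rel orbC. Qed.

Fact path_irr : irreflexive path_rel.
Proof. by move=> i; rewrite /path_rel orbb gtn_eqF. Qed.

Definition path_graph : sgraph := SGraph path_sym path_irr.

(* The condition [i != j] only matters for k = 1; this is C_k for k >= 3. *)
Definition cycle_rel : rel 'I_k := fun i j =>
  (i != j) && ((i.+1 == j %[mod k]) || (j.+1 == i %[mod k])).

Fact cycle_sym : symmetric cycle_rel.
Proof. by move=> i j; rewrite /cycle_rel eq_sym orbC. Qed.

Fact cycle_irr : irreflexive cycle_rel.
Proof. by move=> i; rewrite /cycle_rel eqxx. Qed.

Definition cycle_graph : sgraph := SGraph cycle_sym cycle_irr.
End PathCycle.

(* G has a (not necessarily induced) subgraph isomorphic to H. *)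
Definition has_subgraph (G H : sgraph) : bool :=
  [exists f : {ffun H -> G}, injectiveb f &&
     [forall x, forall y, adj x y ==> adj (f x) (f y)]].

Definition isomorphic (G H : sgraph) : Prop :=
  exists2 f : G -> H, bijective f & forall x y, adj (f x) (f y) = adj x y.

Definition components (G : sgraph) : {set {set G}} :=
  equivalence_partition (connect (@adj G)) [set: G].

Definition path_vertex_cover (k : nat) (G : sgraph) (T : {set G}) : bool :=
  ~~ has_subgraph (induced (~: T)) (path_graph k).

(* Meaningful for k >= 1, where [set: G] is a k-path vertex cover; there is
   no 0-path vertex cover. *)
Definition psi (k : nat) (G : sgraph) : nat :=
  #|[arg min_(T < [set: G] | path_vertex_cover k T) #|T| ]|.

Lemma path_vertex_coverT (k : nat) (G : sgraph) :
  0 < k -> path_vertex_cover k [set: G].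
Proof.
move=> k_gt0; apply/existsP => -[f _].
by case: (f (Ordinal k_gt0)) => x; rewrite !inE.
Qed.

Lemma psi_min (k : nat) (G : sgraph) : 0 < k ->
  (exists2 T : {set G}, path_vertex_cover k T & #|T| = psi k G) /\
  (forall T : {set G}, path_vertex_cover k T -> psi k G <= #|T|).
Proof.
move=> k_gt0; rewrite /psi.
case: arg_minnP => [|T covT minT]; first exact: path_vertex_coverT.
by split=> //; exists T.
Qed.

(* Main.v *)
Require Import Defs.
From mathcomp Require Import all_boot all_order all_algebra.
From mathcomp Require Import zify.

(** Write w for the number of vertices plus the number of edges. Both parts
    of the theorem come from comparing 4 |T| with w while small pieces are
    deleted from the graph, so everything is said about the subgraphs induced
    by vertex sets S of one fixed graph G.

    Upper bound ([bounded_all], by induction on |S|): pick a few vertices K for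
    the cover and delete them together with a set R that K separates from the
    rest and in which no vertex keeps more than one neighbour
    ([covers_reduce]). The bound for S follows from that of the smaller
    subgraph as soon as w drops by at least 4 |K|, and it is strict when w
    drops by more. Around a vertex chosen by its degree (at least 3 if there is
    one, otherwise 0, 1 or, in a 2-regular graph, 2) such a piece exists, and
    the drop exceeds 4 |K| in all but two cases:
    - a connected component C_4, which costs two cover vertices and carries
      exactly w = 8 ([bounded_square]);
    - a vertex v of degree 3, deleted alone ([bounded_or_cubic]). Here equality
      forces S - v to be a union of 4-cycles. A neighbour a of v then has
      degree 3 as well, so either S - a gives a strict bound or it is 2-regular
      too; the latter makes v adjacent to a and to both neighbours of a on its
      4-cycle, and this five-vertex component has seven edges but is covered by
      two vertices ([bounded_deg3]).
    Hence equality leaves only unions of 4-cycles ([tight]).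

    Lower bound for a union of 4-cycles ([weight_le_covers]): a cover contains
    two vertices of every 4-cycle, since it meets each of the four paths on
    three vertices in it.

    Finally, [tight] describes 4-cycle components by neighbourhoods of
    vertices; [tight_components] identifies this with the components being
    isomorphic to C_4. *)

Set Implicit Arguments.
Unset Strict Implicit.
Unset Printing Implicit Defensive.

(** * Weights, covers and square components of induced subgraphs *)
Section Graph.
Variable G : sgraph.
Implicit Types (A S T K R : {set G}) (x y z p q r s : G).

Definition nbrs S x : {set G} := [set y in S | adj x y].

Definition weight S : nat := #|S| + #|[set e in edges G | e \subset S]|.

(** [T] meets every path on three vertices of the subgraph induced by [S]:
    no vertex left over is the middle of such a path. *)
Definition covers S T : Prop :=
  forall x, x \in S :\: T -> #|nbrs (S :\: T) x| <= 1.

(** The 4-cycle p q r s is a component of the subgraph induced by [S]: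
    prescribing the whole neighbourhoods excludes chords and outgoing edges. *)
Definition square S p q r s : Prop :=
  [/\ p \in S, p != r, q != s &
   [/\ nbrs S p = [set q; s], nbrs S q = [set p; r],
       nbrs S r = [set q; s] & nbrs S s = [set p; r]]].

Definition tight S : Prop :=
  forall x, x \in S -> exists y z t, square S x y z t.

Lemma nbrsP S x y : (y \in nbrs S x) = (y \in S) && adj x y.
Proof. by rewrite inE. Qed.

Lemma nbrs_sym S x y : x \in S -> y \in nbrs S x -> x \in nbrs S y.
Proof. by rewrite !nbrsP => -> /andP[_]; rewrite adj_sym. Qed.

Lemma nbrs_irr S x : x \notin nbrs S x.
Proof. by rewrite nbrsP adj_irr andbF. Qed.

Lemma nbrs_neq S x y : y \in nbrs S x -> x != y.
Proof. by apply: contraL => /eqP<-; apply: nbrs_irr. Qed.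

Lemma nbrsD1 S x y : nbrs (S :\ x) y = nbrs S y :\ x.
Proof. by apply/setP=> z; rewrite !inE andbA. Qed.

Lemma nbrsD S T y : nbrs (S :\: T) y = nbrs S y :\: T.
Proof. by apply/setP=> z; rewrite !inE andbA. Qed.

(** The edges lost with [x] correspond to its neighbours. All edge counts
    below are obtained by deleting vertices one at a time. *)
Lemma weightD1 S x : x \in S -> weight S = weight (S :\ x) + #|nbrs S x|.+1.
Proof.
move=> xS; rewrite /weight (cardsD1 x S) xS.
rewrite -(cardsID [set e : {set G} | x \in e] [set e in edges G | e \subset S]).
set E := [set e in edges G | e \subset S]; set X := [set e : {set G} | x \in e].
have -> : E :\: X = [set e in edges G | e \subset S :\ x].
  by apply/setP=> e; rewrite !inE subsetD1; case: (x \in e); rewrite ?andbF ?andbT.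
suff -> : E :&: X = [set [set x; y] | y in nbrs S x].
  rewrite card_in_imset; first by rewrite add1n addSn addnS addnA addnAC.
  move=> y z /nbrs_neq xy _ /setP/(_ y); rewrite !inE eqxx orbT eq_sym (negPf xy) /=.
  by move/esym/eqP.
apply/setP=> e; rewrite !inE; apply/idP/imsetP.
  case/andP=> /andP[/imsetP[[u v]]]; rewrite inE /= => uv -> /subsetP sS.
  have uS : u \in S by apply: sS; rewrite !inE eqxx.
  have vS : v \in S by apply: sS; rewrite !inE eqxx orbT.
  rewrite !inE => /orP[]/eqP->; first by exists v; rewrite ?inE ?vS.
  by exists u; rewrite ?inE ?uS 1?adj_sym // setUC.
case=> y; rewrite inE => /andP[yS xy] ->.
rewrite !inE eqxx andbT; apply/andP; split.
  by apply/imsetP; exists (x, y); rewrite ?inE.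
by apply/subsetP=> z; rewrite !inE => /orP[]/eqP->.
Qed.

Lemma weight_sub S T : S \subset T -> weight S <= weight T.
Proof.
move=> sST; rewrite leq_add ?subset_leq_card //.
by apply/subsetP=> e; rewrite !inE => /andP[->] /subset_trans->.
Qed.

Lemma weight0 : weight set0 = 0.
Proof.
rewrite /weight cards0; apply/eqP; rewrite cards_eq0; apply/eqP/setP=> e.
rewrite !inE; apply/negP=> /andP[/imsetP[[u v] _ ->]].
by move/subsetP/(_ u); rewrite !inE eqxx => /(_ isT).
Qed.

(** One inclusion expresses both requirements on [R]: its vertices have no
    neighbour outside [R] and [K], and at most one inside [R]. A vertex with no
    neighbour in [R] may take itself for [y]. *)
Lemma covers_reduce S K R T :
  {in R, forall x, exists2 y, y \in R & nbrs S x \subset y |: K} ->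
  covers (S :\: (K :|: R)) T -> covers S (T :|: K).
Proof.
move=> RP cT x; rewrite !inE negb_or -andbA => /and3P[xT xK xS].
have [xR|xR] := boolP (x \in R).
  have [y _ /subsetP sy] := RP _ xR.
  rewrite -(cards1 y) subset_leq_card //; apply/subsetP=> z.
  rewrite nbrsD in_setD => /andP[zTK /sy]; rewrite !inE in zTK *.
  by case: (z == y) => //= zK; rewrite zK orbT in zTK.
apply: leq_trans (cT x _); last by rewrite !inE negb_or xT xK xR.
rewrite subset_leq_card //; apply/subsetP=> z; rewrite !inE !negb_or.
case/andP=> /andP[/andP[-> zK] zS] xz; rewrite zK zS xz !andbT /=.
apply/negP=> zR; have [y yR /subsetP/(_ x)] := RP _ zR.
rewrite !inE xS adj_sym xz (negPf xK) orbF => /(_ isT)/eqP xy.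
by rewrite xy yR in xR.
Qed.

Lemma nbrs_closed S R y :
  R \subset S -> nbrs S y \subset R -> nbrs R y = nbrs S y.
Proof.
move=> /subsetP RS /subsetP yR; apply/setP=> z; apply/idP/idP => [|zy].
  by rewrite !nbrsP => /andP[/RS-> ->].
by have:= zy; rewrite !nbrsP (yR _ zy) => /andP[].
Qed.

Lemma square_closed S R p q r s :
  R \subset S -> {in R, forall y, nbrs S y \subset R} -> p \in R ->
  square R p q r s <-> square S p q r s.
Proof.
move=> RS Rcl pR.
have RE y : y \in R -> nbrs R y = nbrs S y.
  by move=> yR; apply: nbrs_closed => //; apply: Rcl.
have mem y z : y \in R -> z \in nbrs S y -> z \in R.
  by move=> /Rcl/subsetP; apply.
split=> -[pS pr qs [Np Nq Nr Ns]].
  have qR : q \in R by apply: (mem p) => //; rewrite -RE // Np !inE eqxx.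
  have sR : s \in R by apply: (mem p) => //; rewrite -RE // Np !inE eqxx orbT.
  have rR : r \in R by apply: (mem q) => //; rewrite -RE // Nq !inE eqxx orbT.
  by split=> //; [apply: (subsetP RS) | rewrite -!RE].
have qR : q \in R by apply: (mem p) => //; rewrite Np !inE eqxx.
have sR : s \in R by apply: (mem p) => //; rewrite Np !inE eqxx orbT.
have rR : r \in R by apply: (mem q) => //; rewrite Nq !inE eqxx orbT.
by split=> //; rewrite !RE.
Qed.

Lemma square_rot S p q r s : square S p q r s -> square S q r s p.
Proof.
case=> pS pr qs [Np Nq Nr Ns]; split=> //; last by split; rewrite // setUC.
  by have: q \in nbrs S p; [rewrite Np !inE eqxx | rewrite nbrsP => /andP[]].
by rewrite eq_sym.
Qed.

Lemma square_mem S p q r s : square S p q r s ->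
  [/\ p \in S, q \in S, r \in S & s \in S].
Proof.
move=> sq; have sq1 := square_rot sq; have sq2 := square_rot sq1.
by have [] := square_rot sq2; case: sq; case: sq1; case: sq2.
Qed.

Lemma square_neq S p q r s : square S p q r s ->
  [/\ p != q, p != s, r != q & r != s].
Proof.
case=> _ _ _ [Np _ Nr _].
by split; apply: (@nbrs_neq S); rewrite ?Np ?Nr !inE eqxx ?orbT.
Qed.

(** Four vertices and four edges. *)
Lemma weight_square S p q r s : square S p q r s ->
  weight S = weight (S :\: [set p; q; r; s]) + 8.
Proof.
move=> sq; have [pS qS rS sS] := square_mem sq.
have [pq ps rq rs] := square_neq sq.
have /and4P[qp sp qr sr] : [&& q != p, s != p, q != r & s != r].
  by rewrite ![_ == p]eq_sym ![_ == r]eq_sym pq ps rq rs.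
case: sq => _ pr qs [Np Nq Nr Ns].
rewrite (weightD1 pS) (@weightD1 _ r) ?inE 1?eq_sym ?pr //.
rewrite (@weightD1 _ q) ?inE ?qp ?qr //.
rewrite (@weightD1 _ s) ?inE ?(eq_sym s q) ?qs ?sp ?sr //.
rewrite !nbrsD1 Np Nr Nq Ns.
have -> : [set q; s] :\ p = [set q; s].
  by apply/setDidPl; rewrite disjoint_sym disjoints1 !inE negb_or pq ps.
have -> : [set p; r] :\ p :\ r = set0.
  by apply/setP=> z; rewrite !inE; do 2!case: (z == _).
rewrite set0D cards0 cards2 qs.
have -> : S :\ p :\ r :\ q :\ s = S :\: [set p; q; r; s].
  by apply/setP=> z; rewrite !inE; do 4!case: (z == _).
clear; lia.
Qed.

Lemma square_complement_closed S p q r s (D := [set p; q; r; s]) :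
  square S p q r s -> {in S :\: D, forall y, nbrs S y \subset S :\: D}.
Proof.
move=> sq y; rewrite in_setD => /andP[yD yS]; apply/subsetP=> z zy.
rewrite in_setD andbC; have := zy; rewrite nbrsP => /andP[-> _] /=.
apply: contra yD; move: (nbrs_sym yS zy); case: sq => _ _ _ [Np Nq Nr Ns] yz.
rewrite !in_setU !in_set1 -!orbA => /or4P[]/eqP zE; move: yz;
  by rewrite zE ?Np ?Nq ?Nr ?Ns !in_set2 => /orP[]/eqP->; rewrite eqxx ?orbT.
Qed.

Lemma tight_square S p q r s : square S p q r s ->
  tight (S :\: [set p; q; r; s]) <-> tight S.
Proof.
move=> sq; have cl := square_complement_closed sq.
have sub := subsetDl S [set p; q; r; s].
split=> tS x xS; last first.
  have [y [z [t /(square_closed _ _ _ sub cl xS) sqx]]] := tS x (subsetP sub _ xS).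
  by exists y, z, t.
have [xD|xD] := boolP (x \in [set p; q; r; s]); last first.
  have xSD : x \in S :\: [set p; q; r; s] by rewrite in_setD xD.
  have [y [z [t /(square_closed _ _ _ sub cl xSD) sqx]]] := tS x xSD.
  by exists y, z, t.
have sq1 := square_rot sq; have sq2 := square_rot sq1.
have sq3 := square_rot sq2.
move: xD; rewrite !in_setU !in_set1 -!orbA => /or4P[]/eqP->.
- by exists q, r, s.
- by exists r, s, p.
- by exists s, p, q.
- by exists p, q, r; apply: square_rot.
Qed.

Lemma tight_deg S x : tight S -> x \in S -> #|nbrs S x| = 2.
Proof. by move=> tS /tS[y [z [t [_ _ yt [-> _ _ _]]]]]; rewrite cards2 yt. Qed.

(** Removing two opposite vertices isolates the other two. *)
Lemma covers_square S p q r s T : square S p q r s ->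
  covers (S :\: [set p; q; r; s]) T -> covers S (T :|: [set p; r]).
Proof.
case=> _ _ _ [_ Nq _ Ns] cT.
apply: (@covers_reduce _ _ [set q; s]).
  move=> x; rewrite in_set2 => xqs; exists x; first by rewrite in_set2.
  by case/orP: xqs => /eqP->; rewrite ?Nq ?Ns subsetUr.
congr (covers (S :\: _) T): cT.
by apply/setP=> z; rewrite !inE; do 4!case: (z == _).
Qed.

(** * The upper bound *)
Definition bounded S : Prop := exists T,
  [/\ covers S T, 4 * #|T| <= weight S & 4 * #|T| = weight S -> tight S].

Lemma leq_card_setU T K : #|T :|: K| <= #|T| + #|K|.
Proof. by rewrite cardsU leq_subr. Qed.

(** Since the inequality is strict, the smaller subgraph may be any bounded
    one, tight or not. *)
Lemma bounded_strict S K R :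
  {in R, forall x, exists2 y, y \in R & nbrs S x \subset y |: K} ->
  bounded (S :\: (K :|: R)) ->
  weight (S :\: (K :|: R)) + 4 * #|K| < weight S -> bounded S.
Proof.
move=> RP [T [cT leT _]] lt; have leU := leq_card_setU T K.
exists (T :|: K); split; first exact: covers_reduce cT; lia.
Qed.

Lemma weight_drop S x A : x \in S -> A \subset nbrs S x ->
  weight (S :\ x) + #|A| < weight S.
Proof. by move=> xS /subset_leq_card lA; rewrite (weightD1 xS) addnS ltnS leq_add2l. Qed.

Lemma bounded_square S p q r s : square S p q r s ->
  bounded (S :\: [set p; q; r; s]) -> bounded S.
Proof.
move=> sq [T [cT leT eqT]]; have := leq_card_setU T [set p; r].
have := weight_square sq.
rewrite cards2; case: (sq) => _ -> _ _ wE leU.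
exists (T :|: [set p; r]); split; [exact: (covers_square sq) | lia |].
by move=> eqU; apply/(tight_square sq)/eqT; lia.
Qed.

(** The star at [v] has weight at least 4, the price of one cover vertex, and
    exactly 4 only in degree 3. *)
Lemma bounded_or_cubic S v : v \in S -> 2 < #|nbrs S v| -> bounded (S :\ v) ->
  bounded S \/ #|nbrs S v| = 3 /\ tight (S :\ v).
Proof.
move=> vS deg [T [cT leT eqT]]; have wE := weightD1 vS.
have [/andP[/eqP d3 /eqP/eqT tv]|ne] :=
  boolP ((#|nbrs S v| == 3) && (4 * #|T| == weight (S :\ v))).
  by right.
left; have := leq_card_setU T [set v]; rewrite cards1 => leU.
exists (T :|: [set v]); split; [|lia|lia].
by apply: (@covers_reduce _ _ set0) => [x|]; rewrite ?inE // setU0.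
Qed.

Lemma card2_mem A x : #|A| = 2 -> x \in A ->
  exists2 y, x != y & A = [set x; y].
Proof.
move=> A2 xA; have := cardsD1 x A; rewrite A2 xA add1n => -[/esym/eqP].
case/cards1P=> y Ay; exists y; last by rewrite -(setD1K xA) Ay.
have: y \in A :\ x by rewrite Ay set11.
by rewrite in_setD1 eq_sym => /andP[].
Qed.

Lemma in_nbrs S x y : y \in nbrs S x -> y \in S.
Proof. by rewrite nbrsP => /andP[]. Qed.

(** The exceptional case of [bounded_or_cubic] is used for [v] and for one of
    its neighbours [a]: the 4-cycle a b c d of S - v and the 2-regularity of
    S - a make a, b, c, d, v a component that [b] and [d] cover. *)
Lemma bounded_deg3 S v : (forall S', S' \proper S -> bounded S') ->
  v \in S -> 2 < #|nbrs S v| -> bounded S.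
Proof.
move=> IH vS deg.
have [//|[v3 tv]] := bounded_or_cubic vS deg (IH _ (properD1 vS)).
have /card_gt0P[a av] : 0 < #|nbrs S v| by rewrite v3.
have aS := in_nbrs av; have va := nbrs_sym vS av.
have aSv : a \in S :\ v by rewrite in_setD1 aS eq_sym (nbrs_neq av).
have [b [c [d sq]]] := tv _ aSv.
have [_ bS cS dS] := square_mem sq; have [ab ad cb cd] := square_neq sq.
case: (sq) => _ ac bd [Na Nb Nc Nd]; rewrite !nbrsD1 in Na Nb Nc Nd.
have a3 : #|nbrs S a| = 3 by rewrite (cardsD1 v) va Na cards2 bd.
have a_gt2 : 2 < #|nbrs S a| by rewrite a3.
have [//|[_ ta]] := bounded_or_cubic aS a_gt2 (IH _ (properD1 aS)).
(* [b] and [d] lose [a] in S - a but still have degree 2 there, so [v] is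
   their third neighbour. *)
have third x : x \in S -> x != a -> nbrs S x :\ v = [set a; c] -> v \in nbrs S x.
  move=> xS xa Nx; have x2 : #|nbrs (S :\ a) x| = 2.
    by apply: tight_deg; rewrite // in_setD1 xa.
  have := cardsD1 v (nbrs S x); have := cardsD1 a (nbrs S x).
  have -> : a \in nbrs S x.
    by have := set21 a c; rewrite -Nx in_setD1 => /andP[].
  by rewrite -(nbrsD1 S a) x2 Nx cards2 ac => ->; case: (v \in _).
move: bS cS dS; rewrite !in_setD1 => /andP[bv bS] /andP[cv cS] /andP[dv dS].
have vb : v \in nbrs S b by apply: third; rewrite // eq_sym.
have vd : v \in nbrs S d by apply: third; rewrite // eq_sym.
have Nv : nbrs S v = [set a; b; d].
  apply/esym/eqP; rewrite eqEcard v3; apply/andP; split.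
    by apply/subsetP=> x; rewrite !in_setU !in_set1 -orbA => /or3P[]/eqP->;
      rewrite ?av // nbrs_sym.
  by rewrite -setUA cardsU1 cards2 bd in_set2 negb_or ab ad.
have {Na}Na : nbrs S a = [set v; b; d] by rewrite -(setD1K va) Na setUA.
have {Nc}Nc : nbrs S c = [set b; d].
  rewrite -Nc; apply/esym/setDidPl; rewrite disjoint_sym disjoints1.
  apply/negP=> /(nbrs_sym cS); rewrite Nv !in_setU !in_set1.
  by rewrite eq_sym (negPf ac) (negPf cb) (negPf cd).
apply: (@bounded_strict _ [set b; d] [set a; v; c]).
- move=> x; rewrite !in_setU !in_set1 -orbA => /or3P[]/eqP->.
  + by exists v; rewrite ?inE ?eqxx ?orbT // Na setUA.
  + by exists a; rewrite ?inE ?eqxx ?orbT // Nv setUA.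
  + by exists c; rewrite ?inE ?eqxx ?orbT // Nc subsetUr.
- apply: IH; apply/properP; split; first exact: subsetDl.
  by exists v; rewrite ?in_setD ?vS ?inE ?eqxx ?orbT.
(* Deleting v, a and b alone removes 4 + 3 + 2 > 8. *)
have := @weight_drop S v [set a; b; d] vS; rewrite Nv => /(_ (subxx _)).
rewrite -Nv v3.
have := @weight_drop (S :\ v) a [set b; d] aSv; rewrite cards2 bd.
have -> : [set b; d] \subset nbrs (S :\ v) a by case: sq => _ _ _ [-> _ _ _].
move/(_ isT); have bSva : b \in S :\ v :\ a by rewrite !in_setD1 bv bS eq_sym ab.
have := @weight_drop _ b [set c] bSva; rewrite cards1.
have -> : [set c] \subset nbrs (S :\ v :\ a) b.
  by rewrite sub1set !nbrsD1 Nb !inE eqxx orbT eq_sym ac.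
move/(_ isT).
have : weight (S :\: ([set b; d] :|: [set a; v; c])) <= weight (S :\ v :\ a :\ b).
  apply: weight_sub; apply/subsetP=> z; rewrite !inE.
  by do 5!case: (z == _).
clear; lia.
Qed.

Lemma bounded_deg0 S v : (forall S', S' \proper S -> bounded S') ->
  v \in S -> #|nbrs S v| = 0 -> bounded S.
Proof.
move=> IH vS /cards0_eq Nv; have SE : S :\: (set0 :|: [set v]) = S :\ v by rewrite set0U.
apply: (@bounded_strict _ set0 [set v]); rewrite ?SE; first last.
- by have := @weight_drop S v set0 vS (sub0set _); rewrite cards0.
- by apply: IH; apply: properD1.
by move=> x /set1P->; exists v; rewrite ?set11 // Nv sub0set.
Qed.

(** Let [w] be the neighbour of [v]. If [w] has a second neighbour [x], then
    [x] is put in the cover and the path v w x, of weight at least 5, is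
    deleted; otherwise the edge v w is a component that needs no cover. *)
Lemma bounded_deg1 S v : (forall S', S' \proper S -> bounded S') ->
  v \in S -> {in S, forall x, #|nbrs S x| <= 2} -> #|nbrs S v| = 1 -> bounded S.
Proof.
move=> IH vS deg2 /eqP/cards1P[w Nv].
have wv : w \in nbrs S v by rewrite Nv set11.
have wS := in_nbrs wv; have vw := nbrs_sym vS wv; have v_w := nbrs_neq wv.
have wSv : w \in S :\ v by rewrite in_setD1 wS eq_sym v_w.
have := weight_drop vS (subxx (nbrs S v)); rewrite Nv cards1 => lt_v.
have bnd K : bounded (S :\: (K :|: [set v; w])).
  apply: IH; apply/properP; split; first exact: subsetDl.
  by exists v; rewrite // in_setD in_setU set21 orbT.
have [w2|w1] := eqVneq #|nbrs S w| 2.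
  have [x vx Nw] := card2_mem w2 vw.
  have xw : x \in nbrs S w by rewrite Nw set22.
  have xS := in_nbrs xw; have w_x := nbrs_neq xw.
  apply: (@bounded_strict _ [set x] [set v; w]) => //.
    move=> y; rewrite in_set2 => /orP[]/eqP->.
      by exists w; rewrite ?set22 // Nv subsetUl.
    by exists v; rewrite ?set21 // Nw.
  have := @weight_drop (S :\ v) w [set x] wSv; rewrite cards1 nbrsD1 sub1set.
  rewrite in_setD1 eq_sym vx xw => /(_ isT).
  have xSvw : x \in S :\ v :\ w by rewrite !in_setD1 xS !(eq_sym x) vx w_x.
  have := weight_drop xSvw (sub0set _).
  have : weight (S :\: ([set x] :|: [set v; w])) <= weight (S :\ v :\ w :\ x).
    by apply: weight_sub; apply/subsetP=> z; rewrite !inE; do 3!case: (z == _).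
  move: lt_v; clear; lia.
have {w1}/cards1P[x Nw] : #|nbrs S w| == 1.
  by rewrite eqn_leq -ltnS ltn_neqAle w1 deg2 //= card_gt0; apply/set0Pn; exists v.
apply: (@bounded_strict _ set0 [set v; w]) => //.
  move=> y; rewrite in_set2 => /orP[]/eqP->.
    by exists w; rewrite ?set22 // Nv setU0.
  by exists v; rewrite ?set21 // setU0; move: vw; rewrite Nw => /set1P->.
have : weight (S :\: (set0 :|: [set v; w])) <= weight (S :\ v).
  by apply: weight_sub; apply/subsetP=> z; rewrite !inE; do 2!case: (z == _).
rewrite cards0; move: lt_v; clear; lia.
Qed.

(** The component of [v] is a cycle containing c a v b d, where [c] and [d] may
    coincide with other vertices: c = b gives a triangle, c = d the 4-cycle.
    On a longer cycle the vertices [c] and [b] are put in the cover and the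
    path c a v b is deleted: four vertices and at least five edges, as the
    second edge at each of its two ends goes with it. *)
Lemma bounded_2regular S v : (forall S', S' \proper S -> bounded S') ->
  v \in S -> {in S, forall x, #|nbrs S x| = 2} -> bounded S.
Proof.
move=> IH vS deg2.
have bnd (D : {set G}) : v \in D -> bounded (S :\: D).
  move=> vD; apply: IH; apply/properP; split; first exact: subsetDl.
  by exists v; rewrite // in_setD vD.
have /card_gt0P[a av] : 0 < #|nbrs S v| by rewrite deg2.
have [b a_b Nv] := card2_mem (deg2 v vS) av.
have aS := in_nbrs av; have va := nbrs_sym vS av; have v_a := nbrs_neq av.
have bv : b \in nbrs S v by rewrite Nv set22.
have bS := in_nbrs bv; have vb := nbrs_sym vS bv; have v_b := nbrs_neq bv.
have [c v_c Na] := card2_mem (deg2 a aS) va.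
have [d v_d Nb] := card2_mem (deg2 b bS) vb.
have ca : c \in nbrs S a by rewrite Na set22.
have cS := in_nbrs ca; have ac := nbrs_sym aS ca; have a_c := nbrs_neq ca.
have db : d \in nbrs S b by rewrite Nb set22.
have dS := in_nbrs db; have bd := nbrs_sym bS db; have b_d := nbrs_neq db.
have wv := weight_drop vS (subxx (nbrs S v)); rewrite deg2 // in wv.
have [cb|c_b] := eqVneq c b.
  have da : d = a.
    have: a \in nbrs S b by rewrite -cb.
    by rewrite Nb in_set2 eq_sym (negPf v_a) => /eqP.
  apply: (@bounded_strict _ [set a] [set v; b]).
  - move=> x; rewrite in_set2 => /orP[]/eqP->.
      by exists b; rewrite ?set22 // Nv setUC.
    by exists v; rewrite ?set21 // Nb da.
  - by apply: bnd; rewrite !inE eqxx orbT.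
  have aSv : a \in S :\ v by rewrite in_setD1 aS eq_sym v_a.
  have := @weight_drop _ a [set b] aSv; rewrite cards1 nbrsD1 sub1set.
  rewrite in_setD1 -{2}cb ca eq_sym v_b => /(_ isT).
  have : weight (S :\: ([set a] :|: [set v; b])) <= weight (S :\ v :\ a).
    by apply: weight_sub; apply/subsetP=> z; rewrite !inE; do 3!case: (z == _).
  rewrite cards1; move: wv; clear; lia.
have [cd|c_d] := eqVneq c d.
  have [e a_e Nc] := card2_mem (deg2 c cS) ac.
  have eb : b = e.
    by move: bd; rewrite -cd Nc in_set2 eq_sym (negPf a_b) => /eqP.
  apply: (@bounded_square _ v a c b); last by apply: bnd; rewrite !inE eqxx.
  by split=> //; split; rewrite ?Nc -?eb ?Nb -?cd //.
apply: (@bounded_strict _ [set c; b] [set a; v]).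
- move=> x; rewrite in_set2 => /orP[]/eqP->.
    by exists v; rewrite ?set22 // Na setUA subsetUl.
  by exists a; rewrite ?set21 // Nv (setUC [set c]) setUA subsetUl.
- by apply: bnd; rewrite !inE eqxx !orbT.
(* Deleting c, b, a, v in this order removes 3 + 3 + 2 + 1 > 8. *)
have wc := weight_drop cS (subxx (nbrs S c)); rewrite deg2 // in wc.
have bSc : b \in S :\ c by rewrite in_setD1 bS eq_sym c_b.
have := @weight_drop _ b [set v; d] bSc; rewrite cards2 v_d nbrsD1.
have -> : [set v; d] \subset nbrs S b :\ c.
  by rewrite subsetD1 Nb subxx in_set2 negb_or eq_sym v_c c_d.
move/(_ isT).
have aScb : a \in S :\ c :\ b by rewrite !in_setD1 a_b a_c.
have := @weight_drop _ a [set v] aScb; rewrite cards1 !nbrsD1 sub1set.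
rewrite !in_setD1 v_b v_c va => /(_ isT).
have vScba : v \in S :\ c :\ b :\ a by rewrite !in_setD1 v_a v_b v_c.
have := weight_drop vScba (sub0set _).
have : weight (S :\: ([set c; b] :|: [set a; v])) <= weight (S :\ c :\ b :\ a :\ v).
  by apply: weight_sub; apply/subsetP=> z; rewrite !inE; do 4!case: (z == _).
rewrite cards2 c_b; move: wc; clear; lia.
Qed.

Lemma bounded_all S : bounded S.
Proof.
have [n] := ubnP #|S|; elim: n S => // n IHn S ltS.
have IH S' : S' \proper S -> bounded S'.
  by move=> /proper_card ltS'; apply: IHn; apply: leq_trans ltS' _.
have [->|[v0 v0S]] := set_0Vmem S.
  by exists set0; split=> [x||_ x]; rewrite ?cards0 // !inE ?andbF.
have [/existsP[v /andP[vS]]|/existsPn/= le2] :=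
  boolP [exists v, (v \in S) && (2 < #|nbrs S v|)].
  exact: bounded_deg3.
have {}le2 : {in S, forall x, #|nbrs S x| <= 2}.
  by move=> x xS; have := le2 x; rewrite xS -leqNgt.
have [/existsP[v /andP[vS]]|/existsPn/= ge2] :=
  boolP [exists v, (v \in S) && (#|nbrs S v| < 2)].
  rewrite ltnS leq_eqVlt ltnS leqn0 => /orP[]/eqP; last exact: bounded_deg0.
  exact: bounded_deg1.
apply: bounded_2regular v0S _ => // x xS.
by have := ge2 x; rewrite xS /= -leqNgt => ?; apply/eqP; rewrite eqn_leq le2.
Qed.

(** * Unions of squares attain the bound *)
Lemma coversD S T A : covers S T -> covers (S :\: A) (T :\: A).
Proof.
move=> cT x; have sub : (S :\: A) :\: (T :\: A) \subset S :\: T.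
  by apply/subsetP=> z; rewrite !inE; case: (z \in A); rewrite //= andbT.
move=> /(subsetP sub)/cT; apply: leq_trans; apply: subset_leq_card.
by apply/subsetP=> z; rewrite !nbrsP => /andP[/(subsetP sub)-> ->].
Qed.

(** The path q p s has to be met; the three other paths on three vertices of
    the square are obtained by rotation. *)
Lemma square_hit S p q r s T : square S p q r s -> covers S T ->
  (p \in T) || (q \in T) || (s \in T).
Proof.
move=> sq cT; have [pS qS rS sS] := square_mem sq.
case: sq => _ _ q_s [Np _ _ _].
rewrite -orbA; apply: contraT; rewrite !negb_or => /and3P[pT qT sT].
have := cT p; rewrite in_setD pT pS nbrsD => /(_ isT).
have -> : nbrs S p :\: T = [set q; s].
  by rewrite Np; apply/setDidPl; rewrite disjoint_sym disjoints_subset;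
    apply/subsetP=> z zT; rewrite !inE negb_or; apply/andP; split;
    apply: contraTN zT => /eqP->.
by rewrite cards2 q_s.
Qed.

Lemma weight_le_covers S T : tight S -> covers S T -> weight S <= 4 * #|T|.
Proof.
have [n] := ubnP #|S|; elim: n S T => // n IHn S T ltS tS cT.
have [->|[p pS]] := set_0Vmem S; first by rewrite weight0.
have [q [r [s sq]]] := tS p pS; have wE := weight_square sq.
set D := [set p; q; r; s] in wE.
have leD : weight (S :\: D) <= 4 * #|T :\: D|.
  apply: IHn; last exact: coversD.
    rewrite -ltnS; apply: leq_trans ltS; rewrite ltnS; apply: proper_card; apply/properP.
    by split; [apply: subsetDl | exists p; rewrite // !inE eqxx].
  exact/tight_square.
have sq1 := square_rot sq; have sq2 := square_rot sq1; have sq3 := square_rot sq2.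
have [pq ps rq rs] := square_neq sq; have [_ pr qs _] := sq.
have TE : #|T| = (p \in T) + (q \in T) + (r \in T) + (s \in T) + #|T :\: D|.
  rewrite (cardsD1 p T) (cardsD1 q) (cardsD1 r) (cardsD1 s) !in_setD1.
  rewrite (eq_sym q p) (eq_sym r p) (eq_sym s p) (eq_sym s q) (eq_sym s r).
  rewrite pq pr ps rq qs rs /= !addnA; congr (_ + #|pred_of_set _|).
  by apply/setP=> z; rewrite !inE; do 4!case: (z == _).
suff : 2 <= (p \in T) + (q \in T) + (r \in T) + (s \in T).
  by move: leD wE TE; clear; lia.
move: (square_hit sq cT) (square_hit sq1 cT) (square_hit sq2 cT) (square_hit sq3 cT).
by case: (p \in T); case: (q \in T); case: (r \in T); case: (s \in T).
Qed.

(** * Covers as 3-path vertex covers, squares as components *)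
Lemma covers_path_vertex_cover T :
  covers [set: G] T <-> path_vertex_cover 3 T.
Proof.
rewrite /path_vertex_cover; split=> [cT|noP x].
  apply/negP=> /existsP[f /andP[/injectiveP injf /forallP homf]].
  pose i k : 'I_3 := inord k.
  have adjf j k : path_rel j k -> adj (val (f j)) (val (f k)).
    by move=> jk; have /forallP/(_ k)/implyP := homf j; apply.
  have fT j : val (f j) \notin T by have := valP (f j); rewrite in_setC.
  have := cT (val (f (i 1))); rewrite in_setD fT in_setT => /(_ isT).
  apply/negP; rewrite -ltnNge; apply/card_gt1P.
  exists (val (f (i 0))), (val (f (i 2))).
  rewrite !nbrsP !in_setD !fT !in_setT /= !adjf /path_rel ?inordK //; split=> //.
  by rewrite (inj_eq val_inj) (inj_eq injf) -val_eqE /= !inordK.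
rewrite setTD => xT; rewrite leqNgt; apply: contra noP => /card_gt1P[y [z []]].
rewrite !nbrsP => /andP[yT xy] /andP[zT xz] yz.
pose H : finType := {x : G | x \in ~: T}.
pose f : {ffun 'I_3 -> H} := [ffun i : 'I_3 =>
  nth (Sub x xT) [:: Sub y yT; Sub x xT; Sub z zT] i].
apply/existsP; exists f; apply/andP; split.
  apply/injectiveP=> -[[|[|[|//]]] ?] [[|[|[|//]]] ?]; rewrite !ffunE /= => /(congr1 val)/= E;
    apply/val_inj => //=; move: xy xz yz; rewrite ?E ?adj_irr ?eqxx // -?E ?adj_irr ?eqxx //.
apply/forallP=> -[[|[|[|//]]] ?]; apply/forallP=> -[[|[|[|//]]] ?];
  apply/implyP; rewrite !ffunE //= /induced_rel /= => _ //; by rewrite adj_sym.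
Qed.

Lemma mem_components C : C \in components G ->
  exists2 x, x \in C & C = [set y | connect (@adj G) x y].
Proof.
case/imsetP=> x _ ->; exists x; rewrite ?inE ?connect0 //.
by apply/setP=> y; rewrite !inE.
Qed.

Lemma component_in_components x : [set y | connect (@adj G) x y] \in components G.
Proof.
by apply/imsetP; exists x; rewrite ?inE //; apply/setP=> y; rewrite !inE.
Qed.

Lemma square_component p q r s : square [set: G] p q r s ->
  [set y | connect (@adj G) p y] = [set p; q; r; s].
Proof.
move=> sq; have [_ _ _ [Np Nq Nr Ns]] := sq.
have nb x y : y \in nbrs [set: G] x -> adj x y by rewrite nbrsP inE.
have pq : adj p q by apply: nb; rewrite Np set21.
have ps : adj p s by apply: nb; rewrite Np set22.
have qr : adj q r by apply: nb; rewrite Nq set22.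
apply/setP=> y; rewrite inE; apply/idP/idP => [py|].
  have cl : closed (@adj G) (mem [set p; q; r; s]).
    apply: intro_closed; first exact/sym_connect_sym/adj_sym.
    move=> u v uv; rewrite !in_setU !in_set1 -!orbA.
    have: v \in nbrs [set: G] u by rewrite nbrsP in_setT uv.
    move=> vu /or4P[]/eqP uE; move: vu; rewrite uE ?Np ?Nq ?Nr ?Ns in_set2;
      by case/orP=> ->; rewrite ?orbT.
  by rewrite -(closed_connect cl py) !inE eqxx.
rewrite !in_setU !in_set1 -!orbA => /or4P[]/eqP->; try exact: connect1.
  exact: connect0.
exact: connect_trans (connect1 pq) (connect1 qr).
Qed.

Lemma square_isomorphic p q r s : square [set: G] p q r s ->
  isomorphic (induced [set p; q; r; s]) (cycle_graph 4).
Proof.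
move=> sq; have [pq ps rq rs] := square_neq sq.
case: sq => _ pr qs [Np Nq Nr Ns].
have adjE x y : adj x y = (y \in nbrs [set: G] x) by rewrite nbrsP inE.
have neqs := (negPf pq, negPf ps, negPf rq, negPf rs, negPf pr, negPf qs).
have neqs' : ((q == p = false) * (s == p = false) * (q == r = false)
  * (s == r = false) * (r == p = false) * (s == q = false))%type.
  by do ![split]; rewrite eq_sym neqs.
(* A vertex is sent to its position on the cycle p q r s. *)
pose f (u : induced [set p; q; r; s]) : cycle_graph 4 := 
  inord (index (val u) [:: p; q; r; s]).
have uP (u : induced [set p; q; r; s]) :
   [\/ val u = p, val u = q, val u = r | val u = s].
  by have := valP u; rewrite !in_setU !in_set1 -!orbA => /or4P[]/eqP->;
    [constructor 1|constructor 2|constructor 3|constructor 4].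
exists f.
  apply: inj_card_bij.
    move=> u v /(congr1 val)/=; rewrite /f /=.
    case: (uP u) => Eu; case: (uP v) => Ev; rewrite Eu Ev /= ?eqxx ?neqs ?neqs' ?inordK // => _;
      by apply: val_inj; rewrite /= Eu Ev.
  rewrite card_ord card_sig.
  rewrite (_ : #|_| = #|[set p; q; r; s]|); last exact: eq_card.
  by rewrite -!setUA !cardsU1 cards1 !inE !neqs !neqs'.
move=> u v; rewrite [RHS]/= /induced_rel adjE [LHS]/= /cycle_rel -val_eqE /f /=.
by case: (uP u) => ->; case: (uP v) => ->; rewrite ?Np ?Nq ?Nr ?Ns !inE /= ?eqxx ?neqs ?neqs' /= ?inordK.
Qed.

Lemma cycle4_adj (i j : cycle_graph 4) :
  adj i j = (j == ordS i) || (j == ordS (ordS (ordS i))).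
Proof. by case: i j => [[|[|[|[|//]]]] ?] [[|[|[|[|//]]]] ?]. Qed.

(** Around the cycle, the predecessor of a position is its third successor,
    so the square starting at [x] is read off by iterating [ordS]. *)
Lemma isomorphic_square x :
  isomorphic (induced [set y | connect (@adj G) x y]) (cycle_graph 4) ->
  exists y z t, square [set: G] x y z t.
Proof.
set C := [set y | _]; case=> f [g fK gK] fadj.
have xC : x \in C by rewrite inE connect0.
have closedC y z : y \in C -> adj y z -> z \in C.
  by rewrite !inE => /connect_trans xy yz; apply/xy/connect1.
pose h i := val (g i).
have h_inj i j : (h i == h j) = (i == j).
  by rewrite (inj_eq val_inj) (inj_eq (can_inj gK)).
have nbrs_h i : nbrs [set: G] (h i) = [set h (ordS i); h (ordS (ordS (ordS i)))].
  have hadj j : adj (h i) (h j) = adj i j by rewrite -{2}(gK i) -{2}(gK j) fadj.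
  apply/setP=> y; rewrite nbrsP in_setT /= in_set2; apply/idP/idP => [iy|].
    have yC := closedC _ _ (valP (g i)) iy.
    have [j yE] : exists j, y = h j by exists (f (Sub y yC)); rewrite /h fK.
    by rewrite yE !h_inj -cycle4_adj -hadj -yE.
  by case/orP=> /eqP->; rewrite hadj cycle4_adj eqxx ?orbT.
have S4 i : ordS (ordS (ordS (ordS i))) = i :> 'I_4.
  by apply: val_inj; case: i => [[|[|[|[|//]]]] ?].
pose i := f (Sub x xC).
have <- : h i = x by rewrite /h fK.
exists (h (ordS i)), (h (ordS (ordS i))), (h (ordS (ordS (ordS i)))).
split; rewrite ?in_setT ?h_inj //.
- by case: i => [[|[|[|[|//]]]] ?].
- by case: i => [[|[|[|[|//]]]] ?].
by split; rewrite nbrs_h ?S4 // setUC.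
Qed.

Lemma tight_components : tight [set: G] <->
  forall C, C \in components G -> isomorphic (induced C) (cycle_graph 4).
Proof.
split=> [tG C /mem_components[p _ ->]|iso x _].
  have [q [r [s sq]]] := tG p (in_setT p).
  by rewrite (square_component sq); apply: square_isomorphic.
exact/isomorphic_square/iso/component_in_components.
Qed.

Lemma psi3_bounds : 4 * psi 3 G <= order_of G + size_of G /\
  (4 * psi 3 G = order_of G + size_of G <-> tight [set: G]).
Proof.
have wG : weight [set: G] = order_of G + size_of G.
  rewrite /weight cardsT; congr (_ + _); apply: eq_card => e.
  by rewrite inE subsetT andbT.
have [[T0 cT0 T0E] minT] := psi_min G (isT : 0 < 3).
have [T [cT leT eqT]] := bounded_all [set: G]; rewrite -wG.
have le_psi : 4 * psi 3 G <= 4 * #|T|.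
  by rewrite leq_mul2l minT //; apply/covers_path_vertex_cover.
have le_w := leq_trans le_psi leT.
split=> //; split=> [eq|tG].
  by apply: eqT; apply/eqP; rewrite eqn_leq leT -eq.
apply/eqP; rewrite eqn_leq le_w -T0E /=; apply: weight_le_covers => //.
exact/covers_path_vertex_cover.
Qed.

End Graph.

Import Order.TTheory GRing.Theory Num.Theory.
Local Open Scope ring_scope.

Theorem theorem4 (G : sgraph) :
  (psi 3 G)%:R <= ((order_of G)%:R + (size_of G)%:R) / 4%:R :> rat /\
  ((psi 3 G)%:R = ((order_of G)%:R + (size_of G)%:R) / 4%:R :> rat <->
   forall C : {set G}, C \in components G ->
     isomorphic (induced C) (cycle_graph 4)).
Proof.
have [le eq] := psi3_bounds G.
have four : 4%:R != 0 :> rat by [].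
split.
  by rewrite ler_pdivlMr // -natrM -natrD ler_nat mulnC.
rewrite -tight_components -eq; split=> E.
  by apply/eqP; rewrite -(eqr_nat rat) natrM natrD mulrC E divfK.
by apply: (mulIf four); rewrite divfK // -natrM mulnC E natrD.
Qed.
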